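(* Let $K/k$ be a finite separable field extension with Galois closure $\widetilde K$, let $G=\mathrm{Gal}(\widetilde K/k)$ and $G'=\mathrm{Gal}(\widetilde K/K)$, and let $\lambda: G\to \mathrm{Perm}(G/G')$ be the left translation action on left cosets. Suppose $K/k$ is a Hopf Galois extension with Hopf algebra $H=\widetilde K[N]^G$ for a regular subgroup $N$ of $\mathrm{Perm}(G/G')$ normalized by $\lambda(G)$. Then the map $$\mathcal F_N:\{\text{subgroups } N'\subseteq N \text{ stable under conjugation by } \lambda(G)\}\longrightarrow \{\text{fields } E \mid k\subseteq E\subseteq K\},\qquad N'\mapsto K^{\widetilde K[N']^G},$$ is injective and inclusion reversing.
   Context: A finite field extension $K/k$ is Hopf Galois with Hopf algebra $H$ if $H$ is a finite (finite-dimensional) cocommutative $k$-Hopf algebra, $K$ is an $H$-module algebra, and the $k$-linear map $j:K\otimes_k H\to \mathrm{End}_k(K)$, $j(s\otimes h)(t)=s(ht)$, is bijective. A subgroup of $\mathrm{Perm}(X)$ is regular if it acts simply transitively on $X$. For $N$ a regular subgroup of $\mathrm{Perm}(G/G')$ normalized by $\lambda(G)$ and $N'\subseteq N$ a subgroup stable under conjugation by $\lambda(G)$ (i.e. $\lambda(\sigma)N'\lambda(\sigma)^{-1}=N'$ for all $\sigma\in G$), the group $G$ acts on the group algebra $\widetilde K[N']$ by $\sigma\left(\sum_{\tau}a_\tau\tau\right)=\sum_\tau \sigma(a_\tau)\,\lambda(\sigma)\tau\lambda(\sigma)^{-1}$, and $\widetilde K[N']^G$ denotes the set of elements fixed by $G$,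 a sub-Hopf algebra over $k$ of $\widetilde K[N]^G$. By Greither–Pareigis, $\widetilde K[N]^G$ gives a Hopf Galois structure on $K/k$, with action on $x\in K$ given by $\left(\sum_\tau a_\tau \tau\right)\cdot x=\sum_\tau a_\tau\, \tau^{-1}(\bar 1)(x)$, where $\bar 1=G'$ is the trivial coset and a coset $gG'$ acts on $x\in K$ by $x\mapsto g(x)$. For a sub-Hopf algebra $H'$ of $H$, with counit $\varepsilon$, $K^{H'}=\{x\in K\mid h\cdot x=\varepsilon(h)x \ \text{for all } h\in H'\}$. *)

(* Defs.v *)
From HB Require Import structures.
From mathcomp Require Import all_boot all_order all_algebra all_fingroup.
From mathcomp Require Import all_solvable all_field.

Set Implicit Arguments.
Unset Strict Implicit.
Unset Printing Implicit Defensive.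

Import GRing.Theory.
Local Open Scope ring_scope.

(* Elements of V (x) W (resp. U (x) V (x) W) are written as formal sums of pure
   tensors, i.e. lists of pairs (resp. triples). Two formal sums denote the same
   tensor iff every bilinear (resp. trilinear) map takes the same value on them. *)

Definition tens_eq (k : fieldType) (V W : lmodType k) (s t : seq (V * W)) : Prop :=
  forall (Z : lmodType k) (f : V -> W -> Z),
    (forall w, linear (f^~ w)) -> (forall v, linear (f v)) ->
  \sum_(p <- s) f p.1 p.2 = \sum_(p <- t) f p.1 p.2.

Definition tens3_eq (k : fieldType) (U V W : lmodType k)
    (s t : seq (U * V * W)) : Prop :=
  forall (Z : lmodType k) (f : U -> V -> W -> Z),
    (forall v w, linear (fun u => f u v w)) ->
    (forall u w, linear (fun v => f u v w)) ->
    (forall u v, linear (f u v)) ->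
  \sum_(p <- s) f p.1.1 p.1.2 p.2 = \sum_(p <- t) f p.1.1 p.1.2 p.2.

Record hopf_algebra (k : fieldType) (H : falgType k) := HopfAlgebra {
  comul : H -> seq (H * H);
  counit : H -> k;
  antipode : H -> H;
  comul_linear : forall a x y,
    tens_eq (comul (a *: x + y))
            ([seq (a *: p.1, p.2) | p <- comul x] ++ comul y);
  comul1 : tens_eq (comul 1) [:: (1, 1)];
  comulM : forall x y,
    tens_eq (comul (x * y))
            [seq (p.1 * q.1, p.2 * q.2) | p <- comul x, q <- comul y];
  counit_scalar : scalar counit;
  counit1 : counit 1 = 1;
  counitM : {morph counit : x y / x * y};
  antipode_linear : linear antipode;
  comulA : forall x,
    tens3_eq [seq (q.1, q.2, p.2) | p <- comul x, q <- comul p.1]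
             [seq (p.1, q.1, q.2) | p <- comul x, q <- comul p.2];
  counit_comul : forall x, \sum_(p <- comul x) counit p.1 *: p.2 = x;
  comul_counit : forall x, \sum_(p <- comul x) counit p.2 *: p.1 = x;
  antipode_comul : forall x,
    \sum_(p <- comul x) antipode p.1 * p.2 = (counit x)%:A;
  comul_antipode : forall x,
    \sum_(p <- comul x) p.1 * antipode p.2 = (counit x)%:A
}.

Definition cocommutative (k : fieldType) (H : falgType k)
    (D : hopf_algebra H) : Prop :=
  forall x, tens_eq (comul D x) [seq (p.2, p.1) | p <- comul D x].

Record module_algebra (k : fieldType) (H : falgType k) (D : hopf_algebra H)
    (A : falgType k) (act : H -> A -> A) : Prop := ModuleAlgebra {
  act_linearl : forall x, linear (act^~ x);
  act_linearr : forall h, linear (act h);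
  act1h : forall x, act 1 x = x;
  actMh : forall h h' x, act (h * h') x = act h (act h' x);
  act_one : forall h, act h 1 = (counit D h)%:A;
  act_mul : forall h x y,
    act h (x * y) = \sum_(p <- comul D h) act p.1 x * act p.2 y
}.

(* The map j : K (x) H -> End_k(K), j(s (x) h)(t) = s (h t). *)
Definition jmap (k : fieldType) (H : falgType k) (K : fieldExtType k)
    (act : H -> K -> K) (s : seq (K * H)) (t : K) : K :=
  \sum_(p <- s) p.1 * act p.2 t.

Record hopf_galois (k : fieldType) (K : fieldExtType k) (H : falgType k)
    (D : hopf_algebra H) (act : H -> K -> K) : Prop := HopfGalois {
  hg_cocommutative : cocommutative D;
  hg_module_algebra : module_algebra D act;
  hg_inj : forall s t : seq (K * H), jmap act s =1 jmap act t -> tens_eq s t;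
  hg_surj : forall f : 'End(K), exists s : seq (K * H), jmap act s =1 f
}.

(* The group algebra L[Perm(T)]; f stands for \sum_s f(s) s.
   MathComp's (s * t)%g on permutations is "s, then t", whereas Perm(T) is
   multiplied here by composition of functions: the product of s and u as group
   algebra elements is x |-> s (u x), which is (u * s)%g. *)
Section PermAlgebra.

Variables (k : fieldType) (L : fieldExtType k) (T : finType).

Definition perm_alg : Type := {ffun {perm T} -> L}.

HB.instance Definition _ := Vector.copy perm_alg {ffun {perm T} -> L}.

Implicit Types f g h : perm_alg.

Definition pa_coef (s : {perm T}) f : L := (f : {ffun _ -> _}) s.

Definition pa_one : perm_alg := [ffun s => (s == 1%g)%:R].

Definition pa_mul f g : perm_alg :=
  [ffun r => \sum_s pa_coef s f * pa_coef (r * s^-1)%g g].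

Lemma pa_coef_is_linear s : linear (pa_coef s).
Proof. by move=> a f g; rewrite /pa_coef !ffunE. Qed.

HB.instance Definition _ s :=
  GRing.isLinear.Build k perm_alg L _ (pa_coef s) (pa_coef_is_linear s).

Lemma perm_algP f g : (forall s, pa_coef s f = pa_coef s g) -> f = g.
Proof. by move=> fg; apply/ffunP => s; apply: fg. Qed.

Lemma pa_coef1 s : pa_coef s pa_one = (s == 1%g)%:R.
Proof. by rewrite /pa_coef ffunE. Qed.

Lemma pa_coefM r f g :
  pa_coef r (pa_mul f g) = \sum_s pa_coef s f * pa_coef (r * s^-1)%g g.
Proof. by rewrite {1}/pa_coef ffunE. Qed.

Lemma pa_mulA : associative pa_mul.
Proof.
move=> f g h; apply: perm_algP => r; rewrite !pa_coefM.
under [RHS]eq_bigr => s _ do rewrite pa_coefM mulr_suml.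
rewrite exchange_big /=; apply: eq_bigr => s _; rewrite pa_coefM mulr_sumr.
rewrite [RHS](reindex_inj (mulIg s)) /=; apply: eq_bigr => u _.
by rewrite mulgK invMg !mulgA mulrA.
Qed.

Lemma pa_mul1 : left_id pa_one pa_mul.
Proof.
move=> f; apply: perm_algP => r; rewrite pa_coefM (bigD1 1%g) //= big1.
  by rewrite pa_coef1 eqxx mul1r invg1 mulg1 addr0.
by move=> s s1; rewrite pa_coef1 (negPf s1) mul0r.
Qed.

Lemma pa_mulr1 : right_id pa_one pa_mul.
Proof.
move=> f; apply: perm_algP => r; rewrite pa_coefM (bigD1 r) //= big1.
  by rewrite pa_coef1 mulgV eqxx mulr1 addr0.
by move=> s s1; rewrite pa_coef1 -eq_mulgV1 eq_sym (negPf s1) mulr0.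
Qed.

Lemma pa_mulDl : left_distributive pa_mul +%R.
Proof.
move=> f g h; apply: perm_algP => r; rewrite linearD /= !pa_coefM -big_split.
by apply: eq_bigr => s _; rewrite linearD mulrDl.
Qed.

Lemma pa_mulDr : right_distributive pa_mul +%R.
Proof.
move=> f g h; apply: perm_algP => r; rewrite linearD /= !pa_coefM -big_split.
by apply: eq_bigr => s _; rewrite linearD mulrDr.
Qed.

Lemma pa_one_neq0 : pa_one != 0.
Proof.
apply/eqP => /(congr1 (pa_coef 1%g)); rewrite pa_coef1 eqxx linear0.
by apply/eqP; exact: oner_neq0.
Qed.

HB.instance Definition _ := GRing.Zmodule_isNzRing.Build perm_alg
  pa_mulA pa_mul1 pa_mulr1 pa_mulDl pa_mulDr pa_one_neq0.

Lemma pa_scaleAl (a : k) f g : a *: (f * g) = (a *: f) * g.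
Proof.
apply: perm_algP => r; rewrite linearZ /= !pa_coefM scaler_sumr.
by apply: eq_bigr => s _; rewrite linearZ /= scalerAl.
Qed.

HB.instance Definition _ := GRing.Lmodule_isLalgebra.Build k perm_alg pa_scaleAl.

Lemma pa_scaleAr (a : k) f g : a *: (f * g) = f * (a *: g).
Proof.
apply: perm_algP => r; rewrite linearZ /= !pa_coefM scaler_sumr.
by apply: eq_bigr => s _; rewrite linearZ /= scalerAr.
Qed.

HB.instance Definition _ := GRing.Lalgebra_isAlgebra.Build k perm_alg pa_scaleAr.
HB.instance Definition _ := Algebra_isFalgebra.Build k perm_alg.

Definition pa_aug f : L := \sum_s pa_coef s f.

End PermAlgebra.

(* In a group whose MathComp product (x * y)%g is "x, then y", the left coset gH
   for composition is the MathComp right coset H :* g, and left translation by s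
   is C |-> C :* s (lemma val_ltrans). *)
Section LeftTranslation.

Variables (gT : finGroupType) (G H : {group gT}).

Definition lcosets_comp : finType := {C : {set gT} | C \in rcosets H G}.

Definition ltrans (s : gT) : {perm lcosets_comp} :=
  actperm (@subaction _ _ _ _ lcosets_comp ('Rs)%act) s.

Lemma val_ltrans s (C : lcosets_comp) :
  s \in G -> val (ltrans s C) = (val C :* s)%g.
Proof.
move=> Gs; rewrite actpermE val_subact ifT /= ?rcosetE //.
apply/astabsP => D; rewrite /= rcosetE !inE.
apply/rcosetsP/rcosetsP => -[x Gx defD].
  exists (x * s^-1)%g; first by rewrite groupM ?groupV.
  by rewrite rcosetM -defD -rcosetM mulgV rcoset1.
by exists (x * s)%g; rewrite ?groupM // rcosetM defD.
Qed.

Lemma lcoset1_subproof : (H : {set gT}) \in rcosets H G.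
Proof. by apply/rcosetsP; exists 1%g; rewrite ?group1 ?rcoset1. Qed.

Definition lcoset1 : lcosets_comp :=
  exist (fun C : {set gT} => is_true (C \in rcosets H G)) _ lcoset1_subproof.

End LeftTranslation.

Section GreitherPareigis.

Variables (k : fieldType) (L : splittingFieldType k) (K : {subfield L}).

Definition is_galois_closure : Prop :=
  galois 1 {:L} /\
  forall E : {subfield L}, (K <= E)%VS -> galois 1 E -> E = {:L}%VS :> {vspace L}.

Local Notation G := ('Gal({:L} / 1%VS)%G).
Local Notation G' := ('Gal({:L} / K)%G).

(* In gal_of, (x * y)%g is "x, then y" (galM), so left cosets and left
   translation for composition of automorphisms are lcosets_comp and ltrans. *)
Definition cosets : finType := lcosets_comp G G'.
Definition lambda (s : gal_of {:L}) : {perm cosets} := ltrans G G' s.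
Definition coset1 : cosets := lcoset1 G G'.

(* gG' acts on x \in K by x |-> g(x). *)
Definition coset_act (C : cosets) (x : L) : L := (repr (val C) : gal_of _) x.

Definition regular_subgroup (N : {group {perm cosets}}) : Prop :=
  forall x y : cosets, exists! n : {perm cosets}, n \in N /\ n x = y.

(* (A :^ x)%g is x^-1 * A * x in MathComp, that is
   lambda(s) o A o lambda(s)^-1 when x = lambda s. *)
Definition conj_stable (A : {set {perm cosets}}) : bool :=
  [forall s in G, (A :^ lambda s)%g == A].

Definition stable_subgroup (N : {group {perm cosets}}) : finType :=
  {N' : {group {perm cosets}} | (N' \subset N) && conj_stable N'}.

Local Notation A := (perm_alg L cosets).

(* \sum_t a_t t |-> \sum_t s(a_t) (lambda(s) o t o lambda(s)^-1) *)
Definition pa_gal (s : gal_of {:L}) (h : A) : A :=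
  [ffun t => s (pa_coef (t ^ (lambda s)^-1)%g h)].

Lemma pa_coef_gal s t h :
  pa_coef t (pa_gal s h) = s (pa_coef (t ^ (lambda s)^-1)%g h).
Proof. by rewrite {1}/pa_coef ffunE. Qed.

Lemma pa_gal_is_linear s : linear (pa_gal s).
Proof.
by move=> a f g; apply: perm_algP => t; rewrite linearP /= !pa_coef_gal !linearP.
Qed.

HB.instance Definition _ s :=
  GRing.isLinear.Build k A A _ (pa_gal s) (pa_gal_is_linear s).

(* L[N']^G, the elements supported on N' that are fixed by G. *)
Definition invariants (N' : {set {perm cosets}}) : {vspace A} :=
  ((\bigcap_(t | t \notin N') lker (linfun (pa_coef t : A -> L))) :&:
   (\bigcap_(s in G) fixedSpace (linfun (pa_gal s))))%VS.

Lemma invariantsP (N' : {set {perm cosets}}) (h : A) :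
  reflect ((forall t, t \notin N' -> pa_coef t h = 0) /\
           (forall s, s \in G -> pa_gal s h = h))
          (h \in invariants N').
Proof.
apply: (iffP idP).
  rewrite memv_cap => /andP[]; rewrite !memvE => /subv_bigcapP h1 /subv_bigcapP h2.
  split=> [t /h1|s /h2]; rewrite -memvE.
    by rewrite memv_ker lfunE => /eqP.
  by move/fixedSpaceP; rewrite lfunE.
case=> h1 h2; rewrite memv_cap !memvE; apply/andP; split; apply/subv_bigcapP.
  by move=> t /h1 ht; rewrite -memvE memv_ker lfunE /= ht.
by move=> s /h2 hs; rewrite -memvE; apply/fixedSpaceP; rewrite lfunE.
Qed.

Lemma invariants_is_aspace (N' : {group {perm cosets}}) :
  is_aspace (invariants N').
Proof.
apply/andP; split.
  apply: has_algid1; apply/invariantsP; split=> [t N't|s Gs].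
    by rewrite pa_coef1; case: eqP N't => // ->; rewrite group1.
  by apply: perm_algP => t; rewrite pa_coef_gal !pa_coef1 conjg_eq1 rmorph_nat.
apply/prodvP => f g /invariantsP[f1 f2] /invariantsP[g1 g2].
apply/invariantsP; split=> [t N't|s Gs].
  rewrite pa_coefM big1 // => u _; have [Nu|/f1->] := boolP (u \in N').
    by rewrite g1 ?mulr0 // groupMr ?groupV.
  by rewrite mul0r.
apply: perm_algP => t; rewrite pa_coef_gal !pa_coefM rmorph_sum /=.
rewrite (reindex_inj (conjg_inj (lambda s)^-1%g)) /=; apply: eq_bigr => u _.
by rewrite rmorphM /= -conjVg -conjMg -!pa_coef_gal f2 ?g2.
Qed.

Canonical invariants_aspace N' : {aspace A} := ASpace (invariants_is_aspace N').

Definition pa_act (h : A) (x : L) : L :=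
  \sum_t pa_coef t h * coset_act (t^-1%g coset1) x.

Definition in_fixed (H' : {vspace A}) (x : L) : Prop :=
  x \in K /\ forall h : A, h \in H' -> pa_act h x = pa_aug h * x.

(* K/k is Hopf Galois with Hopf algebra L[N]^G: the Hopf algebra structure is
   the restriction of that of the group algebra L[N], where
   t |-> t (x) t, t |-> 1, t |-> t^-1, and the action on K is pa_act.
   The comultiplication is compared with that of L[N] through the embedding of
   L[N]^G (x)_k L[N]^G into L[N] (x)_L L[N], the functions on pairs (s, t). *)
Definition hopf_galois_by (N : {group {perm cosets}}) : Prop :=
  let H : falgType k := subvs_of (invariants_aspace N) in
  exists (D : hopf_algebra H) (act : H -> subvs_of K -> subvs_of K),
  [/\ forall h s t,
        \sum_(p <- comul D h) pa_coef s (vsval p.1) * pa_coef t (vsval p.2)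
          = (if s == t then pa_coef s (vsval h) else 0),
      forall h, (counit D h)%:A = pa_aug (vsval h),
      forall h s, pa_coef s (vsval (antipode D h)) = pa_coef s^-1%g (vsval h),
      forall h x, vsval (act h x) = pa_act (vsval h) (vsval x)
    & hopf_galois D act].

End GreitherPareigis.

(* Main.v *)
Require Import Defs.
From mathcomp Require Import all_boot all_order all_algebra all_fingroup.
From mathcomp Require Import all_solvable all_field.

(** Write X for the set of cosets and x0 for the trivial coset, and write
    products as compositions of functions. For x in K,
      h.x - eps(h) x = \sum_t h_t (t^-1(x0)(x) - x),
    and for fixed x the right-hand side is an L-linear form in h, defined on all
    of L[N']. By Galois descent L[N']^G spans L[N'] over L: it contains the
    traces \sum_s s(a) lambda(s) t lambda(s)^-1 with a in L and t in N', and the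
    automorphisms s are linearly independent ([invariants_span]). So x is fixed
    by L[N']^G exactly when every coset in the orbit N' x0 fixes x
    ([in_fixed_invariantsP]).

    As N' is normalized by lambda(G), the N'-orbits are permuted by G, so the
    elements of G that send x0 into N' x0 form a subgroup S(N')
    ([stab_orbit_group_set]), and the elements of K fixed by L[N']^G are the
    field fixed by S(N') ([in_fixed_fixedField]). By Galois theory this field
    determines S(N'); since lambda is transitive, S(N') determines the orbit
    N' x0; and since N is regular, a subgroup of N is determined by its orbit of
    x0 ([stab_orbit_sub]). *)

Set Implicit Arguments.
Unset Strict Implicit.
Unset Printing Implicit Defensive.

Import GRing.Theory.
Local Open Scope ring_scope.

Section StabOrbit.

Variables (gT : finGroupType) (G H : {group gT}).

Local Notation X := (lcosets_comp G H).
Local Notation x0 := (Defs.lcoset1 G H).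
Local Notation lam := (ltrans G H).

Lemma ltransM s r : s \in G -> r \in G -> lam (s * r)%g = (lam s * lam r)%g.
Proof.
move=> Gs Gr; apply/permP => C; apply: val_inj.
by rewrite permM !val_ltrans ?groupM // rcosetM.
Qed.

Lemma mem_repr_lcosets (C : X) : H \subset G -> repr (val C) \in G.
Proof.
move=> sHG; case: C => C /= /rcosetsP[x Gx ->].
have /rcosetP[y Hy ->] := mem_repr_rcoset H x.
by rewrite groupM // (subsetP sHG).
Qed.

Lemma ltrans_repr (C : X) : H \subset G -> lam (repr (val C)) x0 = C.
Proof.
move=> sHG; apply: val_inj; rewrite val_ltrans ?mem_repr_lcosets //=.
by case: C => C /= /rcosetsP[x Gx ->]; rewrite rcoset_repr.
Qed.

Lemma ltrans_stab s : s \in H -> H \subset G -> lam s x0 = x0.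
Proof.
move=> Hs sHG; apply: val_inj; rewrite val_ltrans ?(subsetP sHG) //=.
by rewrite rcoset_id.
Qed.

Definition stab_orbit (A : {set {perm X}}) : {set gT} :=
  [set s in G | lam s x0 \in orbit 'P A x0].

(** With products read as compositions: if lambda(s) x0 = n x0 and
    lambda(r) x0 = m x0 then
    lambda(r) lambda(s) x0 = lambda(r) n x0 = (lambda(r) n lambda(r)^-1) (m x0),
    where the conjugate of n is in A again. *)
Lemma stab_orbit_group_set (A : {group {perm X}}) :
    {in G, forall s, (A :^ lam s)%g = A} -> H \subset G ->
  group_set (stab_orbit A).
Proof.
move=> nAG sHG; apply/group_setP; split.
  by rewrite inE group1 ltrans_stab ?group1 // orbit_refl.
move=> s r; rewrite !inE => /andP[Gs /orbitP[n An /= def_s]].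
case/andP=> Gr /orbitP[m Am /= def_r]; rewrite groupM //=.
apply/orbitP; exists (m * n ^ lam r)%g.
  by rewrite groupM // -(nAG r Gr) memJ_conjg.
rewrite ltransM // permM -def_s /= /aperm permM.
by move: def_r; rewrite /= /aperm => ->; rewrite permJ.
Qed.

Lemma sub_stab_orbit (A : {group {perm X}}) :
  H \subset G -> H \subset stab_orbit A.
Proof.
move=> sHG; apply/subsetP => s Hs.
by rewrite inE (subsetP sHG) // ltrans_stab // orbit_refl.
Qed.

Lemma stab_orbitS (A B : {set {perm X}}) :
  A \subset B -> stab_orbit A \subset stab_orbit B.
Proof.
move=> sAB; apply/subsetP => s; rewrite !inE => /andP[-> /orbitP[n An <-]] /=.
by rewrite mem_orbit // (subsetP sAB).
Qed.

(** By transitivity of lambda, t x0 = lambda(s) x0 for some s; then s lies in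
    the set for A, hence in that for B, and t x0 = u x0 with u in B, so t = u. *)
Lemma stab_orbit_sub (A B : {set {perm X}}) :
    H \subset G -> {in A & B, forall t u : {perm X}, t x0 = u x0 -> t = u} ->
  stab_orbit A \subset stab_orbit B -> A \subset B.
Proof.
move=> sHG injAB sAB; apply/subsetP => t At.
have: repr (val (t x0)) \in stab_orbit A.
  by rewrite inE mem_repr_lcosets // ltrans_repr // (mem_orbit 'P%act x0 At).
move/(subsetP sAB); rewrite inE ltrans_repr // => /andP[_ /orbitP[u Bu /= def_t]].
by rewrite (injAB t u).
Qed.

End StabOrbit.

Section Descent.

Variables (k : fieldType) (L : splittingFieldType k) (K : {subfield L}).

Local Notation G := ('Gal({:L} / 1%VS)%G).
Local Notation A := (perm_alg L (cosets K)).

Definition pa_single (a : L) (t : {perm cosets K}) : A :=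
  [ffun u => if u == t then a else 0].

Definition pa_trace (f : A) : A := \sum_(s in G) pa_gal s f.

Lemma sub_gal_1 : 'Gal({:L} / K)%g \subset G.
Proof. exact: galS (sub1v _). Qed.

Lemma pa_gal_comp r s (f : A) : r \in G -> s \in G ->
  pa_gal r (pa_gal s f) = pa_gal (s * r)%g f.
Proof.
move=> Gr Gs; apply: perm_algP => t; rewrite !pa_coef_gal galM ?memvf //.
by rewrite /lambda ltransM // invMg conjgM.
Qed.

Lemma pa_gal_trace r (f : A) : r \in G -> pa_gal r (pa_trace f) = pa_trace f.
Proof.
move=> Gr; rewrite /pa_trace linear_sum.
rewrite [RHS](reindex_inj (mulIg r)) /=.
by apply: eq_big => s; [rewrite groupMr | move=> Gs; rewrite pa_gal_comp].
Qed.

Lemma pa_coef_trace_single u a t :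
  pa_coef u (pa_trace (pa_single a t)) =
    \sum_(s in G) (if u == (t ^ lambda K s)%g then s a else 0).
Proof.
rewrite /pa_trace linear_sum; apply: eq_bigr => s Gs.
rewrite /= pa_coef_gal {1}/pa_coef ffunE -(inj_eq (conjg_inj (lambda K s))) conjgKV.
by case: ifP => _ //; rewrite rmorph0.
Qed.

Lemma conj_stableP (B : {set {perm cosets K}}) :
  conj_stable B -> {in G, forall s, (B :^ lambda K s)%g = B}.
Proof. by move/forall_inP=> stabB s Gs; apply/eqP/stabB. Qed.

Lemma trace_single_invariants (B : {set {perm cosets K}}) a t :
  conj_stable B -> t \in B -> pa_trace (pa_single a t) \in invariants B.
Proof.
move=> stabB Bt; apply/invariantsP; split=> [u Bu|r Gr]; last exact: pa_gal_trace.
rewrite pa_coef_trace_single big1 // => s Gs; case: eqP => // def_u.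
by case/negP: Bu; rewrite def_u -(conj_stableP stabB Gs) memJ_conjg.
Qed.

(** Galois descent, in dual form: L[B]^G spans L[B] over L, so an L-linear form
    c on the group algebra that vanishes on L[B]^G vanishes on B. On the trace of
    a t the form is \sum_s s(a) c(t ^ lambda s), and the automorphisms s are
    linearly independent. *)
Lemma invariants_span (B : {set {perm cosets K}}) (c : {perm cosets K} -> L) :
    conj_stable B ->
    (forall h, h \in invariants B -> \sum_t pa_coef t h * c t = 0) ->
  {in B, forall t, c t = 0}.
Proof.
move=> stabB c0 t Bt.
have lam1: lambda K 1%g = 1%g.
  by apply: (mulgI (lambda K 1%g)); rewrite mulg1 -ltransM ?group1 ?mulg1.
rewrite -[t in c t]conjg1 -lam1.
apply: (@gal_independent _ _ _ (mem G) (fun s => c (t ^ lambda K s)%g)); last first.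
  exact: group1.
move=> a _; rewrite -[RHS](c0 _ (trace_single_invariants a stabB Bt)).
under [RHS]eq_bigr => u _ do rewrite pa_coef_trace_single mulr_suml.
rewrite exchange_big /=; apply: eq_bigr => s Gs.
rewrite (bigD1 (t ^ lambda K s)%g) //= eqxx big1 ?addr0 1?mulrC //.
by move=> u /negPf->; rewrite mul0r.
Qed.

End Descent.

Section FixedField.

Variables (k : fieldType) (L : splittingFieldType k) (K : {subfield L}).

Local Notation G := ('Gal({:L} / 1%VS)%G).
Local Notation x0 := (Defs.coset1 K).

Lemma pa_act_subE (h : perm_alg L (cosets K)) x :
  pa_act h x - pa_aug h * x =
    \sum_t pa_coef t h * (coset_act (t^-1%g x0) x - x).
Proof.
rewrite /pa_act /pa_aug mulr_suml -sumrB.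
by apply: eq_bigr => t _; rewrite mulrBr.
Qed.

Lemma coset_act_lambda s x :
  s \in G -> x \in K -> coset_act (lambda K s x0) x = s x.
Proof.
move=> Gs Kx; rewrite /coset_act val_ltrans //=.
have /rcosetP[y Gy ->] := mem_repr_rcoset 'Gal({:L} / K)%G s.
by rewrite galM ?memvf // (fixed_gal (subvf K) Gy).
Qed.

(** The descent lemma is applied to the form h |-> h.x - eps(h) x. *)
Lemma in_fixed_invariantsP (B : {group {perm cosets K}}) x :
    conj_stable B ->
  in_fixed (invariants B) x <->
    x \in K /\ {in B, forall t : {perm cosets K}, coset_act (t x0) x = x}.
Proof.
move=> stabB; split=> -[Kx fix_x]; split=> //.
  move=> t Bt; apply/eqP; rewrite -subr_eq0 -[t]invgK; apply/eqP.
  apply: (invariants_span (c := fun u => coset_act (u^-1%g x0) x - x) stabB).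
    by move=> h Bh; rewrite -pa_act_subE fix_x ?subrr.
  by rewrite groupV.
move=> h /invariantsP[supp_h _]; apply/eqP; rewrite -subr_eq0 pa_act_subE.
apply/eqP/big1 => t _; have [Bt | /supp_h->] := boolP (t \in B).
  by rewrite fix_x ?groupV // subrr mulr0.
by rewrite mul0r.
Qed.

(** An element of the field fixed by the stabilizer is in K because the
    stabilizer contains Gal(L/K); a coset of B x0 acts on it through a
    representative, which lies in the stabilizer. *)
Lemma in_fixed_fixedField (B : {group {perm cosets K}}) x :
    galois K {:L} -> conj_stable B ->
  x \in fixedField (stab_orbit B) <-> in_fixed (invariants B) x.
Proof.
move=> galK stabB; apply: iff_trans (iff_sym (in_fixed_invariantsP x stabB)).
have sG'G := sub_gal_1 K; split=> [Sx | [Kx fix_x]].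
  have [_ fix_x] := mem_fixedFieldP Sx; split.
    rewrite -(galois_fixedField galK); apply/(fixedFieldP (memvf x)) => s Gs.
    by apply: fix_x; apply: (subsetP (sub_stab_orbit B sG'G)).
  move=> t Bt; apply: fix_x; rewrite inE mem_repr_lcosets //= ltrans_repr //.
  exact: (mem_orbit 'P%act x0 Bt).
apply/(fixedFieldP (memvf x)) => s; rewrite inE => /andP[Gs /orbitP[t Bt def_s]].
by rewrite -coset_act_lambda // /lambda -def_s; apply: fix_x.
Qed.

End FixedField.

Lemma regular_subgroup_inj (k : fieldType) (L : splittingFieldType k)
    (K : {subfield L}) (N : {group {perm cosets K}}) (x : cosets K) :
  regular_subgroup N -> {in N &, forall t u : {perm cosets K}, t x = u x -> t = u}.
Proof.
move=> regN t u Nt Nu eq_tu; have [n [_ n_uniq]] := regN x (u x).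
by rewrite -(n_uniq t) // -(n_uniq u).
Qed.

Theorem theorem2p3 (k : fieldType) (L : splittingFieldType k) (K : {subfield L})
  (sepK : separable 1%VS K)
  (clK : is_galois_closure K)
  (N : {group {perm cosets K}})
  (regN : regular_subgroup N)
  (normN : conj_stable N)
  (HG : hopf_galois_by N) :
  exists FN : stable_subgroup N -> {E : {subfield L} | (1 <= E <= K)%VS},
    [/\ forall (N' : stable_subgroup N) (x : L),
          x \in sval (FN N') <-> in_fixed (invariants (sval N')) x,
        injective FN
      & forall N1 N2 : stable_subgroup N,
          sval N1 \subset sval N2 -> (sval (FN N2) <= sval (FN N1))%VS].
Proof.
have [galL _] := clK.
have galK: galois K {:L} by apply: galoisS galL; rewrite sub1v subvf.
pose F (N' : stable_subgroup N) : {subfield L} :=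
  fixedField_aspace (stab_orbit (sval N')).
have F_fixed (N' : stable_subgroup N) x :
    x \in F N' <-> in_fixed (invariants (sval N')) x.
  by apply: in_fixed_fixedField galK _; have /andP[] := valP N'.
have F_bounds N' : (1 <= F N' <= K)%VS.
  by rewrite sub1v; apply/subvP => x /F_fixed[].
exists (fun N' => exist _ (F N') (F_bounds N')); split=> //=; last first.
  move=> N1 N2 sN12; apply/subvP => x /mem_fixedFieldP[_ fix_x].
  apply/(fixedFieldP (memvf x)) => s Ss; apply: fix_x.
  exact: subsetP (stab_orbitS sN12) s Ss.
have gal_F (N' : stable_subgroup N) :
    'Gal({:L} / F N')%g = stab_orbit (sval N') :> {set _}.
  have /andP[_ stabN'] := valP N'.
  have gS := stab_orbit_group_set (conj_stableP stabN') (sub_gal_1 K).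
  exact: gal_fixedField (Group gS).
have sub_of_F (N1 N2 : stable_subgroup N) :
    F N1 = F N2 -> sval N1 \subset sval N2.
  move=> eqF; have /andP[sN1 _] := valP N1; have /andP[sN2 _] := valP N2.
  apply: (stab_orbit_sub (sub_gal_1 K)); last by rewrite -!gal_F eqF.
  move=> t u /(subsetP sN1) Nt /(subsetP sN2) Nu.
  exact: regular_subgroup_inj regN t u Nt Nu.
move=> N1 N2 /(congr1 sval) /= eqF; apply/val_inj/val_inj/eqP.
by rewrite eqEsubset !sub_of_F.
Qed.
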